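(* The group $\mathbb{Z}$ (the additive group of integers) is totally $s$-orderable, i.e. $\mathrm{Sp}_{\rm so}(\mathbb{Z})=\omega\setminus\{0,1\}$.
   Context: Here $\omega=\{0,1,2,\ldots\}$. For a natural number $n\ge 2$, an $n$-ary relation $K_n\subseteq Z^n$ on a set $Z$ is an $n$-spherical order if: (nso1) for every even permutation $\sigma$ of $\{1,\ldots,n\}$ and all $x_1,\ldots,x_n\in Z$, $K_n(x_1,\ldots,x_n)$ implies $K_n(x_{\sigma(1)},\ldots,x_{\sigma(n)})$; (nso2) for all $1\le i<j\le n$ and all $x_1,\ldots,x_n\in Z$: both $K_n(x_1,\ldots,x_i,\ldots,x_j,\ldots,x_n)$ and $K_n(x_1,\ldots,x_j,\ldots,x_i,\ldots,x_n)$ (the tuple with the $i$-th and $j$-th entries swapped) hold if and only if $x_k=x_l$ for some $1\le k<l\le n$; (nso3) for all $x_1,\ldots,x_n\in Z$, if $K_n(x_1,\ldots,x_n)$ then for every $t\in Z$ there is $i\in\{1,\ldots,n\}$ with $K_n(x_1,\ldots,x_{i-1},t,x_{i+1},\ldots,x_n)$; (nso4) for all $1\le i<j\le n$ and all $x_1,\ldots,x_n\in Z$: $K_n(x_1,\ldots,x_i,\ldots,x_j,\ldots,x_n)$ or $K_n(x_1,\ldots,x_j,\ldots,x_i,\ldots,x_n)$ holds. A group $G$ is $n$-spherically ordered by an $n$-spherical order $K_n$ on $G$ if for every $(x_1,\ldots,x_n)\in K_n$ and every $y\in G$ the tuples $(x_1y,\ldots,x_ny)$ and $(yx_1,\ldots,yx_n)$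 belong to $K_n$. $G$ is $n$-spherically orderable if there is an $n$-spherical order on $G$ by which $G$ is $n$-spherically ordered. The spectrum of spherical orderability of $G$ is $\mathrm{Sp}_{\rm so}(G)=\{n\in\omega\setminus\{0,1\}\mid G\text{ is }n\text{-spherically orderable}\}$. $G$ is totally $s$-orderable if $\mathrm{Sp}_{\rm so}(G)=\omega\setminus\{0,1\}$. *)

(* Defs.v *)
From mathcomp Require Import all_boot all_fingroup all_algebra.
From mathcomp Require Import classical_sets.

Set Implicit Arguments.
Unset Strict Implicit.
Unset Printing Implicit Defensive.

Local Open Scope classical_set_scope.

Definition tuple_perm (n : nat) (Z : Type) (s : 'S_n) (x : n.-tuple Z) :
    n.-tuple Z :=
  [tuple tnth x (s i) | i < n].

Definition tuple_swap (n : nat) (Z : Type) (i j : 'I_n) (x : n.-tuple Z) :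
    n.-tuple Z :=
  tuple_perm (tperm i j) x.

Definition tuple_subst (n : nat) (Z : Type) (i : 'I_n) (t : Z)
    (x : n.-tuple Z) : n.-tuple Z :=
  [tuple if k == i then t else tnth x k | k < n].

(* Meaningful for 2 <= n only; this bound is imposed in [Sp_so]. *)
Record spherical_order (n : nat) (Z : Type) (K : set (n.-tuple Z)) : Prop := {
  nso1 : forall (s : 'S_n) (x : n.-tuple Z),
    ~~ odd_perm s -> K x -> K (tuple_perm s x);
  nso2 : forall (i j : 'I_n) (x : n.-tuple Z), (i < j)%N ->
    (K x /\ K (tuple_swap i j x)) <->
    (exists k l : 'I_n, (k < l)%N /\ tnth x k = tnth x l);
  nso3 : forall x : n.-tuple Z, K x ->
    forall t : Z, exists i : 'I_n, K (tuple_subst i t x);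
  nso4 : forall (i j : 'I_n) (x : n.-tuple Z), (i < j)%N ->
    K x \/ K (tuple_swap i j x)
}.

Record spherically_ordered_by (n : nat) (G : groupType)
    (K : set (n.-tuple G)) : Prop := {
  spherically_ordered_order : spherical_order K;
  spherically_ordered_mulr : forall (x : n.-tuple G) (y : G),
    K x -> K [tuple (tnth x i * y)%g | i < n];
  spherically_ordered_mull : forall (x : n.-tuple G) (y : G),
    K x -> K [tuple (y * tnth x i)%g | i < n]
}.

Definition spherically_orderable (n : nat) (G : groupType) : Prop :=
  exists K : set (n.-tuple G), spherically_ordered_by K.

Definition Sp_so (G : groupType) : set nat :=
  [set n | (~` [set 0%N; 1%N]) n /\ spherically_orderable n G].

Definition totally_s_orderable (G : groupType) : Prop :=
  Sp_so G = ~` [set 0%N; 1%N].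

(* Main.v *)
Require Import Defs.
From mathcomp Require Import all_boot all_fingroup all_algebra.
From mathcomp Require Import order classical_sets.

(* Send x to the point (1, x, ..., x^(n-1)) of the moment curve, and let
   K_n(x_1, ..., x_n) say that these n vectors have nonnegative determinant.
   The Vandermonde formula shows that the determinant is translation invariant
   and that it vanishes exactly on tuples with a repetition. For (nso3), the n
   determinants obtained by replacing one x_i by t add up to the determinant
   of the x_i, because the points lie on the affine hyperplane of first
   coordinate 1; so these determinants cannot all be negative. *)

Set Implicit Arguments.
Unset Strict Implicit.
Unset Printing Implicit Defensive.

Import Order.TTheory GRing.Theory Num.Theory.
Local Open Scope ring_scope.

Section VandermondeTuple.

Variable R : comNzRingType.

(** The moment vectors are the columns, so permuting or replacing entries acts on columns. *)
Definition vandermonde_tuple (n : nat) (x : n.-tuple R) : 'M[R]_n :=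
  Vandermonde n (\row_i tnth x i).

Lemma det_vandermonde_tuple (n : nat) (x : n.-tuple R) :
  \det (vandermonde_tuple x) =
  \prod_(i < n) \prod_(j < n | (i < j)%N) (tnth x j - tnth x i).
Proof.
rewrite det_Vandermonde; apply: eq_bigr => i _; apply: eq_bigr => j _.
by rewrite !mxE.
Qed.

Lemma det_vandermonde_tuple_perm (n : nat) (s : 'S_n) (x : n.-tuple R) :
  \det (vandermonde_tuple (tuple_perm s x)) =
  (-1) ^+ s * \det (vandermonde_tuple x).
Proof.
have -> : vandermonde_tuple (tuple_perm s x) =
          col_perm s (vandermonde_tuple x).
  by apply/matrixP => i j; rewrite !mxE tnth_mktuple.
by rewrite col_permE det_mulmx det_perm odd_permV mulrC.
Qed.

Lemma det_vandermonde_tuple_swap (n : nat) (i j : 'I_n) (x : n.-tuple R) :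
  i != j ->
  \det (vandermonde_tuple (tuple_swap i j x)) = - \det (vandermonde_tuple x).
Proof.
by move=> ij; rewrite det_vandermonde_tuple_perm odd_tperm ij expr1 mulN1r.
Qed.

Lemma det_vandermonde_tuple_translate (n : nat) (x y : n.-tuple R) (t : R) :
  (forall i, tnth y i = tnth x i + t) ->
  \det (vandermonde_tuple y) = \det (vandermonde_tuple x).
Proof.
move=> yE; rewrite !det_vandermonde_tuple.
apply: eq_bigr => i _; apply: eq_bigr => j _.
by rewrite !yE opprD addrACA subrr addr0.
Qed.

(* The left-hand side is [e *m \adj V *m u], where [e] is the all-ones row,
   i.e. row 0 of [V], and [u] is the moment vector of [t]. *)
Lemma sum_det_vandermonde_tuple_subst (n : nat) (x : n.+1.-tuple R) (t : R) :
  \sum_i \det (vandermonde_tuple (tuple_subst i t x)) =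
  \det (vandermonde_tuple x).
Proof.
set V := vandermonde_tuple x.
have substE i : \det (vandermonde_tuple (tuple_subst i t x)) =
                \sum_(k < n.+1) t ^+ k * (\adj V) i k.
  (* Only column [i] changes under the substitution, so the cofactors along it are those of [V]. *)
  rewrite (expand_det_col _ i); apply: eq_bigr => k _.
  rewrite !mxE tnth_mktuple eqxx; congr (_ * (_ * \det _)).
  apply/matrixP => a b; rewrite !mxE tnth_mktuple.
  by rewrite eq_sym (negPf (neq_lift _ _)).
have V0 i : V ord0 i = 1 by rewrite !mxE expr0.
have sum_adj k : \sum_i (\adj V) i k = \det V *+ (ord0 == k).
  have := congr1 (fun A : 'M_n.+1 => A ord0 k) (mul_mx_adj V).
  by rewrite !mxE => <-; apply: eq_bigr => i _; rewrite V0 mul1r.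
under eq_bigr do rewrite substE.
(* Summing over [i] first kills the coefficient of every [t ^+ k] with [k] nonzero. *)
rewrite exchange_big big_ord_recl /= -mulr_sumr sum_adj expr0 mul1r big1.
  by rewrite addr0.
by move=> k _; rewrite -mulr_sumr sum_adj mulr0.
Qed.

End VandermondeTuple.

Lemma det_vandermonde_tuple_eq0 (R : idomainType) (n : nat) (x : n.-tuple R) :
  \det (vandermonde_tuple x) = 0 <->
  exists k l : 'I_n, (k < l)%N /\ tnth x k = tnth x l.
Proof.
rewrite det_vandermonde_tuple; split=> [/eqP|[k [l [kl xkl]]]].
  move=> /prodf_eq0[k _ /prodf_eq0[l kl]]; rewrite subr_eq0 => /eqP xkl.
  by exists k, l.
by rewrite (bigD1 k) //= (bigD1 l) //= xkl subrr !mul0r.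
Qed.

Definition moment_order (R : realDomainType) (n : nat) : set (n.-tuple R) :=
  [set x | 0 <= \det (vandermonde_tuple x)]%classic.

(** For [n = 0] the determinant is 1, and (nso3) would fail for want of an index. *)
Lemma moment_order_spherical (R : realDomainType) (n : nat) :
  (0 < n)%N -> spherical_order (@moment_order R n).
Proof.
case: n => // n _; split; rewrite /moment_order /=.
- by move=> s x /negPf s_even; rewrite det_vandermonde_tuple_perm s_even mul1r.
- move=> i j x ij; rewrite -det_vandermonde_tuple_eq0.
  rewrite det_vandermonde_tuple_swap ?neq_ltn ?ij // oppr_ge0; split.
    by move=> [x_ge0 x_le0]; apply/eqP; rewrite eq_le x_le0.
  by move=> ->.
- move=> x x_ge0 t; apply/existsP; apply: contraTT x_ge0.
  rewrite negb_exists => /forallP subst_lt0.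
  rewrite -ltNge -(sum_det_vandermonde_tuple_subst x t) -oppr_gt0 -sumrN.
  (* One term split off gives strict positivity; for the rest nonnegativity suffices. *)
  rewrite big_ord_recl ltr_pwDl ?sumr_ge0 // => [|i _].
    by rewrite oppr_gt0 ltNge.
  by rewrite oppr_ge0 ltW // ltNge.
- move=> i j x ij; rewrite det_vandermonde_tuple_swap ?neq_ltn ?ij // oppr_ge0.
  exact/orP/le_total.
Qed.

(* [Algebra.to_multiplicative int] is the additive group of integers, seen as a
   (multiplicatively written) [groupType]. *)
Theorem proposition2p21 : totally_s_orderable (Algebra.to_multiplicative int).
Proof.
apply/seteqP; split=> [n []//|n n_ge2]; split=> //.
have n_gt0 : (0 < n)%N by case: n n_ge2 => // -[]; left.
exists (@moment_order int n); split; first exact: moment_order_spherical.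
- move=> x y; rewrite /moment_order /= => x_ge0.
  rewrite (@det_vandermonde_tuple_translate _ _ x _ (y : int)) // => i.
  exact: tnth_mktuple.
- move=> x y; rewrite /moment_order /= => x_ge0.
  rewrite (@det_vandermonde_tuple_translate _ _ x _ (y : int)) // => i.
  (* Left multiplication is the same translation, since addition commutes. *)
  rewrite [RHS]addrC; exact: tnth_mktuple.
Qed.
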